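(* Consider the controlled system $$x_{k+1}=f(x_k,\,r_0+u_k),\qquad k\ge 0,$$ where, for given $\varepsilon>0$ with $\varepsilon<\min_{i\neq j}\frac{|p_i-p_j|}{2}$, the control is $$u_k=\begin{cases}0 & \text{if } k<k_0,\\ \beta_{(i+k-k_0)\,\mathrm{mod}(m)}\,\big(x_k-p_{(i+k-k_0)\,\mathrm{mod}(m)}\big) & \text{if } k\ge k_0,\end{cases}$$ with $$k_0=k_0(x_0,\varepsilon)=\min\{k\ge0:\ |x_k-p_i|\le\varepsilon\ \text{for some } i,\ 1\le i\le m\},$$ and $i$ in the definition of $u_k$ being the index for which $|x_{k_0}-p_i|\le\varepsilon$. Suppose that the real coefficients $\beta_j$, $1\le j\le m$, satisfy $$\big|f_{\beta_1}'(p_1)\,f_{\beta_2}'(p_2)\cdots f_{\beta_m}'(p_m)\big|<1,$$ and let $\beta=\max_{1\le j\le m}|\beta_j|$. Let $\delta>0$ be given. Then there exists $\varepsilon_0$ with $$0<\varepsilon_0<\min_{i\neq j}\Big\{\frac{|p_i-p_j|}{2};\ \frac{\delta}{\beta}\Big\}$$ such that for all $\varepsilon$ with $0<\varepsilon<\varepsilon_0$, and for almost every initial condition $x_0\in\mathcal{B}$, one has $|u_k|<\delta$ (for all $k$), and $(x_k)_{k\ge1}$ converges to the $m$-periodic orbit $\{p_1,\dots,p_m\}$.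
   Context: Setting: $f(x,r)$ is a real-valued, continuously differentiable function of the real state $x$ and the real scalar parameter $r$. For the nominal value $r=r_0$ the uncontrolled system $x_{k+1}=f(x_k,r_0)$ is chaotic, with a strange attractor $\mathcal{A}$ contained in its basin of attraction $\mathcal{B}\subset\mathbb{R}$. The set $\{p_1,\dots,p_m\}$ is an unstable periodic orbit (UPO) of period $m$ of the uncontrolled system, embedded in the attractor: the $p_i$ are distinct and $p_{i+1}=f(p_i,r_0)$, with indices taken modulo $m$ in $\{1,\dots,m\}$. Standing ergodicity assumption: for almost every initial condition $x_0\in\mathcal{B}$, the trajectory of the uncontrolled system visits every neighborhood of every point of the UPO (so $k_0$ exists for almost every $x_0\in\mathcal{B}$). Notation: for $\beta_i\in\mathbb{R}$, $f_{\beta_i}(x)=f(x,\,r_0+\beta_i(x-p_i))$, and $f_{\beta_i}'$ is its derivative in $x$. Conventions: $\delta$ is the maximal allowed parameter perturbation; $\delta/\beta$ is read as $+\infty$ if $\beta=0$, and for $m=1$ the conditions on $|p_i-p_j|$ are void. Convergence of $(x_k)$ to the periodic orbit means that for some index $s$, $|x_k-p_{(s+k)\,\mathrm{mod}(m)}|\to0$ as $k\to\infty$. *)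

(* Defs.v *)
From HB Require Import structures.
From mathcomp Require Import all_boot all_order all_algebra.
From mathcomp Require Import all_classical all_reals all_analysis.

Set Implicit Arguments.
Unset Strict Implicit.
Unset Printing Implicit Defensive.

Import Order.TTheory GRing.Theory Num.Theory.
Import numFieldNormedType.Exports.

Local Open Scope classical_set_scope.
Local Open Scope ring_scope.

Section Defs.
Context {R : realType}.
Implicit Types (f : R -> R -> R) (g : R -> R) (A B : set R).

(* f is C^1 on R^2: Frechet differentiable at every point, with a continuous
   differential (continuity of z |-> 'D_v F z for every v is, R^2 being
   finite-dimensional, continuity of z |-> 'd F z). *)
Definition continuously_differentiable f : Prop :=
  let F : R * R -> R := fun z => f z.1 z.2 in
  (forall z, differentiable F z) /\ (forall v, continuous ('D_v F)).

Definition basin g A : set R :=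
  [set x0 | forall e : R, 0 < e ->
    \forall k \near \oo, exists2 a, A a & `|iter k g x0 - a| < e].

Definition topologically_transitive g A : Prop :=
  forall U V : set R, open U -> open V -> A `&` U !=set0 -> A `&` V !=set0 ->
    exists k, exists2 a, (A `&` U) a & (A `&` V) (iter k g a).

(* As usual, the nearby state y ranges over the ambient space. *)
Definition sensitive_dependence g A : Prop :=
  exists2 e : R, 0 < e &
    forall a, A a -> forall U, nbhs a U ->
      exists2 y, U y & exists k, e < `|iter k g a - iter k g y|.

(* A strange attractor is a chaotic attractor: a compact invariant set that
   attracts a set of positive measure and on which the dynamics is
   topologically transitive and sensitive to initial conditions. The basin is
   not required to be a neighbourhood of A, so that e.g. [0, 1] qualifies for
   the logistic map 4x(1 - x) on R. *)
Record strange_attractor g A : Prop := StrangeAttractor {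
  attractor_nonempty : A !=set0 ;
  attractor_compact : compact A ;
  attractor_invariant : g @` A = A ;
  attractor_attracts : (0 < @lebesgue_measure R (basin g A))%E ;
  attractor_transitive : topologically_transitive g A ;
  attractor_sensitive : sensitive_dependence g A }.

Lemma attractor_sub_basin g A : strange_attractor g A -> A `<=` basin g A.
Proof.
move=> [_ _ gA _ _ _] a Aa e e0; near=> k.
exists (iter k g a); last by rewrite subrr normr0.
move: (k); elim=> [//|n IH] /=.
by rewrite -gA; exists (iter n g a).
Unshelve. all: by end_near. Qed.

Section Orbit.
Context {m : nat}.
Implicit Types (p beta : 'I_m -> R) (i : 'I_m).

(* Indices 1, ..., m modulo m are represented by 'I_m = {0, ..., m - 1}, with
   cyclic successor ordS; ord_shift i k is the index i + k modulo m. *)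
Definition ord_shift i (k : nat) : 'I_m := iter k (@ordS m) i.

Lemma val_ord_shift i k : ord_shift i k = ((i + k) %% m)%N :> nat.
Proof.
elim: k => [|k IH]; first by rewrite addn0 modn_small.
by rewrite /ord_shift iterS /= -/(ord_shift i k) IH -addn1 modnDml -addnA addn1.
Qed.

Definition periodic_orbit g p : Prop :=
  injective p /\ forall i, p (ordS i) = g (p i).

(* Unstable means not Lyapunov stable. *)
Definition unstable_orbit g p : Prop :=
  exists2 e : R, 0 < e & forall d : R, 0 < d ->
    exists i y, `|y - p i| < d /\ exists k, e <= `|iter k g y - iter k g (p i)|.

Definition unstable_periodic_orbit g p : Prop :=
  periodic_orbit g p /\ unstable_orbit g p.

Definition visits_orbit_ae g B p : Prop :=
  {ae @lebesgue_measure R, forall x0 : R, B x0 ->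
    forall i V, nbhs (p i) V -> exists k, V (iter k g x0)}.

Definition feedback f (r0 : R) p beta i : R -> R :=
  fun y => f y (r0 + beta i * (y - p i)).

Definition near_orbit p (eps : R) : pred R :=
  fun y => [exists i, `|y - p i| <= eps].

(* None when the trajectory never comes eps-close to the orbit, in which case
   the control is never switched on. *)
Definition switch_time p (eps : R) (x : nat -> R) : option nat :=
  if pselect (exists k, near_orbit p eps (x k)) is left h
  then Some (ex_minn h) else None.

(* The index i with |x_{k0} - p_i| <= eps is unique as soon as eps is smaller
   than every |p_i - p_j| / 2, i != j. *)
Definition control p beta (eps : R) (x : nat -> R) (k : nat) : R :=
  if switch_time p eps x is Some k0 then
    if [pick i | `|x k0 - p i| <= eps] is Some i then
      if (k < k0)%N then 0
      else let j := ord_shift i (k - k0) in beta j * (x k - p j)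
    else 0
  else 0.

Definition controlled_trajectory f (r0 : R) p beta (eps : R) (x : nat -> R) : Prop :=
  forall k, x k.+1 = f (x k) (r0 + control p beta eps x k).

Definition converges_to_orbit p (x : nat -> R) : Prop :=
  exists s : 'I_m, (fun k => `|x k - p (ord_shift s k)|) @ \oo --> (0 : R).

Definition half_min_gap p : \bar R :=
  (\big[mine/+oo]_(ij : 'I_m * 'I_m | ij.1 != ij.2)
     (`|p ij.1 - p ij.2| / 2)%:E)%E.

Definition max_gain beta : R := \big[Num.max/0]_(j < m) `|beta j|.

(* The closed loop is well posed: control at time k depends only on x_0..x_k. *)
Lemma controlled_trajectory_exists f (r0 : R) p beta (eps x0 : R) :
  exists2 x, x 0%N = x0 & controlled_trajectory f r0 p beta eps x.
Proof.
pose y k := iter k (f^~ r0) x0.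
have [h|h] := pselect (exists k, near_orbit p eps (y k)); last first.
  exists y => // k; rewrite /control /switch_time.
  by case: pselect => [//|_]; rewrite addr0.
case: (ex_minnP h) => k0 nk0 k0_min.
case Ei : [pick i | `|y k0 - p i| <= eps] => [i|]; last first.
  by case/existsP: nk0 => i; move: Ei; case: pickP => // /(_ i) ->.
pose z := fix z n := if n is n'.+1
  then feedback f r0 p beta (ord_shift i n') (z n') else y k0.
pose x k := if (k < k0)%N then y k else z (k - k0)%N.
have xy k : (k <= k0)%N -> x k = y k.
  rewrite /x leq_eqVlt => /orP[/eqP->|->//].
  by rewrite ltnn subnn.
exists x; first by rewrite xy.
have sx : switch_time p eps x = Some k0.
  rewrite /switch_time; case: pselect => [h'|[]]; last by exists k0; rewrite xy.
  case: (ex_minnP h') => k1 nk1 k1_min; congr Some.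
  apply/eqP; rewrite eqn_leq k1_min ?xy //=.
  by apply: k0_min; rewrite -xy // k1_min // xy.
move=> k; rewrite /control sx (xy k0 (leqnn _)) Ei.
case: ltnP => k0k; first by rewrite !xy // 1?ltnW // addr0.
by rewrite /x ltnNge leqW //= subSn //= ltnNge k0k.
Qed.

End Orbit.
End Defs.

(* Main.v *)
Require Import Defs.
From HB Require Import structures.
From mathcomp Require Import all_boot all_order all_algebra.
From mathcomp Require Import all_classical all_reals all_analysis.
Import Order.TTheory GRing.Theory Num.Theory.
Import numFieldNormedType.Exports.
Local Open Scope classical_set_scope.
Local Open Scope ring_scope.

(** Put [g i := feedback f r0 p beta i]. Once the control is on, a
    state that follows [p i] is moved by the map [g i], which sends [p i] to
    the next orbit point and has derivative [d i] at [p i], with [|prod_i d i| < 1]. Replacing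
    [|d i|] by [L i := |d i| + e] with [e] small keeps [prod_i L i < 1]
    (prod_slack) and leaves enough room for [L i] to bound the error growth
    under [g i] on a whole neighbourhood of radius [rho]
    (derivable_local_gain).

    A single factor [L i] may exceed 1, so the error can grow during a turn
    around the orbit; only the product over a full turn is contracting. Hence
    the product [path_gain L i n] of [n] consecutive factors decays
    geometrically in the number of completed turns, and is bounded by some
    constant [C] (path_gain_bounded, path_gain_cvg0). If the error is at most
    [eps] when the control is switched on and [C * eps] is below [rho], an
    induction shows that the trajectory never leaves the neighbourhoods where
    the bounds are valid, so that its error after [n] steps is at most
    [path_gain L i n * eps] (tracking_error); this tends to 0. The control is
    at most [max_gain beta * C * eps], so it stays below [delta] once [eps] is
    small; because of the transient growth [C], the mere inequality
    [eps < delta / max_gain beta] would not suffice.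

    Ergodicity enters only to start the control: as long as it is off, the
    trajectory is the uncontrolled one, which for almost every initial point of
    the basin comes [eps]-close to the orbit (control_switches_on). *)

(** * Cyclic shifts of indices *)

Lemma ord_shiftD {m : nat} (i : 'I_m) a b :
  ord_shift i (a + b) = ord_shift (ord_shift i a) b.
Proof. by rewrite /ord_shift addnC iterD. Qed.

Lemma ord_shift_period {m : nat} (i : 'I_m) a : ord_shift i (a * m) = i.
Proof.
by apply: val_inj; rewrite /= val_ord_shift addnC modnMDl modn_small.
Qed.

Lemma ord_shift_onto {m : nat} (i : 'I_m) k :
  exists s : 'I_m, ord_shift s k = i.
Proof.
have m_gt0 : (0 < m)%N by case: m i => [[]|].
exists (ord_shift i (k * m - k)).
by rewrite -ord_shiftD subnK ?ord_shift_period// leq_pmulr.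
Qed.

Lemma prod_ord_shift {R : comRingType} {m : nat} (L : 'I_m -> R) (i : 'I_m) :
  \prod_(k < m) L (ord_shift i k) = \prod_(j < m) L j.
Proof.
rewrite [RHS](reindex_inj (h := fun k : 'I_m => ord_shift i k))// => a b ab.
apply/val_inj/eqP; move/(congr1 val)/eqP: ab; rewrite /= !val_ord_shift eqn_modDl.
by rewrite !modn_small.
Qed.

(** * Error growth along the orbit *)

Definition path_gain {R : comRingType} {m : nat} (L : 'I_m -> R) (i : 'I_m)
  (n : nat) : R := \prod_(k < n) L (ord_shift i k).

Section PathGain.
Context {R : realType} {m : nat}.
Variable L : 'I_m -> R.
Hypothesis L_ge0 : forall i, 0 <= L i.
Implicit Type i : 'I_m.

Lemma path_gain_ge0 i n : 0 <= path_gain L i n.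
Proof. exact: prodr_ge0. Qed.

Lemma path_gainD i a b :
  path_gain L i (a + b) = path_gain L i a * path_gain L (ord_shift i a) b.
Proof.
rewrite /path_gain big_split_ord /=; congr (_ * _).
by apply: eq_bigr => k _; rewrite -ord_shiftD.
Qed.

Lemma path_gain_period i a :
  path_gain L i (a * m) = (\prod_(j < m) L j) ^+ a.
Proof.
elim: a => [|a IH]; first by rewrite mul0n /path_gain big_ord0.
by rewrite mulSnr path_gainD IH ord_shift_period exprSr /path_gain prod_ord_shift.
Qed.

(** After removing the completed turns, fewer than [m] factors are left, and
    there are finitely many such partial products; their sum serves as [C]. *)
Lemma path_gain_geometric : exists2 C : R, 0 < C &
  forall i n, path_gain L i n <= (\prod_(j < m) L j) ^+ (n %/ m) * C.
Proof.
(* The extra 1 keeps the constant positive when the index type is empty. *)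
exists (1 + \sum_(j < m) \sum_(b < m) path_gain L j b).
  by rewrite ltr_pwDl// sumr_ge0// => j _; apply: sumr_ge0 => *; exact: path_gain_ge0.
move=> i n; have m_gt0 : (0 < m)%N by case: (m) i => [[]|].
rewrite {1}(divn_eq n m) path_gainD path_gain_period ord_shift_period.
rewrite ler_wpM2l ?exprn_ge0 ?prodr_ge0//.
have sum_ge0 j : 0 <= \sum_(b < m) path_gain L j b.
  by apply: sumr_ge0 => *; exact: path_gain_ge0.
rewrite ler_wpDl// (bigD1 i)//= ler_wpDr ?sumr_ge0//.
rewrite (bigD1 (Ordinal (ltn_pmod n m_gt0)))//= ler_wpDr// sumr_ge0// => *.
exact: path_gain_ge0.
Qed.

Hypothesis L_lt1 : \prod_(j < m) L j < 1.

Lemma path_gain_bounded :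
  exists2 C : R, 0 < C & forall i n, path_gain L i n <= C.
Proof.
have [C C_gt0 CP] := path_gain_geometric; exists C => // i n.
by apply: (le_trans (CP i n)); rewrite ler_piMl ?(ltW C_gt0)// exprn_ile1 ?prodr_ge0 ?(ltW L_lt1).
Qed.

Lemma path_gain_cvg0 i : path_gain L i @ \oo --> (0 : R).
Proof.
have [C C_gt0 CP] := path_gain_geometric.
have m_gt0 : (0 < m)%N by case: (m) i => [[]|].
apply: (@squeeze_cvgr _ _ _ _ (cst 0) (fun n => (\prod_(j < m) L j) ^+ (n %/ m) * C)).
- by near=> n; rewrite path_gain_ge0 CP.
- exact: cvg_cst.
- rewrite -[X in _ --> X](mul0r C); apply: cvgMl.
  have q_cvg : (GRing.exp (\prod_(j < m) L j) : R ^nat) @ \oo --> (0 : R).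
    by apply: cvg_expr; rewrite ger0_norm ?prodr_ge0.
  apply: cvg_comp q_cvg => /=.
  move=> U [N _ NU]; exists (N * m)%N => // n /= Nn.
  by apply: NU => /=; rewrite leq_divRL.
Unshelve. all: by end_near. Qed.

End PathGain.

(** * Linear bounds from derivatives *)

(** A finite product depends continuously on its factors. *)
Lemma prod_slack {R : realType} {m : nat} (d : 'I_m -> R) :
  \prod_(i < m) d i < 1 ->
  exists2 e : R, 0 < e & \prod_(i < m) (d i + e) < 1.
Proof.
move=> d_lt1.
have prod_cvg : \prod_(i < m) (d i + e) @[e --> 0^'+] --> \prod_(i < m) d i.
  apply: cvg_big => [|i _]; first exact: mul_continuous.
  rewrite -[X in _ --> X]addr0; apply: cvgD; first exact: cvg_cst.
  by apply: cvg_at_right_filter; exact: cvg_id.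
have [e [e_gt0 prod_lt1]] :
    exists e : R, 0 < e /\ \prod_(i < m) (d i + e) < 1.
  apply: (@filter_ex _ (0^'+ : set_system R)); near=> e; split.
    by near: e; exact: nbhs_right_gt.
  near: e.
  exact: (cvgr_lt _ prod_cvg _ d_lt1).
by exists e.
Unshelve. all: by end_near. Qed.

(** Close to [a] the difference quotient of [g] at [a] is within [e] of the
    derivative. *)
Lemma derivable_local_gain {R : realType} (g : R -> R) (a e : R) :
  derivable g a 1 -> 0 < e ->
  \forall rho \near 0^'+, forall y, `|y - a| <= rho ->
    `|g y - g a| <= (`|derive1 g a| + e) * `|y - a|.
Proof.
move=> g_der e_gt0.
have := cvgr_dist_lt _ _ g_der _ e_gt0; rewrite -/(derive g a 1) -derive1E.
move=> -[r /= r_gt0 rP].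
near=> rho => y y_rho.
have [->|ya] := eqVneq y a; first by rewrite !subrr normr0 mulr0.
have h_neq0 : y - a != 0 by rewrite subr_eq0.
have : ball_ [eta Num.Def.normr] 0 r (y - a).
  rewrite /ball_ /= sub0r normrN; apply: le_lt_trans y_rho _.
  by near: rho; exact: nbhs_right_lt.
move=> /rP /(_ h_neq0) /=; rewrite -[_%:A]/((y - a) * 1) mulr1 subrK.
rewrite -[_ *: _]/((y - a)^-1 * (g y - g a)) => q_lt.
have -> : g y - g a = (y - a)^-1 * (g y - g a) * (y - a).
  by rewrite mulrAC mulVf ?mul1r.
rewrite normrM ler_wpM2r//.
rewrite -lerBlDl (le_trans _ (ltW q_lt))// distrC; exact: lerB_dist.
Unshelve. all: by end_near. Qed.

(** The bounds on [g] hold only within [rho] of the orbit; the smallness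
    assumption turns the estimate at time [n] into the membership needed to
    apply them once more. *)
Lemma tracking_error {R : realType} {m : nat} (g : 'I_m -> R -> R)
    (p L : 'I_m -> R) (rho : R) (i : 'I_m) (z : nat -> R) :
  (forall j y, `|y - p j| <= rho ->
    `|g j y - p (ordS j)| <= L j * `|y - p j|) ->
  (forall j, 0 <= L j) ->
  (forall n, z n.+1 = g (ord_shift i n) (z n)) ->
  (forall n, path_gain L i n * `|z 0%N - p i| <= rho) ->
  forall n, `|z n - p (ord_shift i n)| <= path_gain L i n * `|z 0%N - p i|.
Proof.
move=> g_gain L_ge0 z_rec small; elim=> [|n IH].
  by rewrite /path_gain big_ord0 mul1r.
rewrite z_rec (le_trans (g_gain _ _ (le_trans IH (small n))))//.
rewrite /path_gain big_ord_recr /= -/(path_gain L i n) [_ * L _]mulrC -mulrA.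
by rewrite ler_wpM2l.
Qed.
(** * The closed loop *)

(** The feedback map is [f] composed with an affine curve in the plane, so
    Frechet differentiability of [f] is what the chain rule needs. *)
Lemma feedback_derivable {R : realType} (f : R -> R -> R) (r0 : R) {m : nat}
    (p beta : 'I_m -> R) (i : 'I_m) (y : R) :
  continuously_differentiable f -> derivable (feedback f r0 p beta i) y 1.
Proof.
move=> [f_diff _]; apply/derivable1_diffP.
pose h (y : R) : R * R := (y, r0 + beta i * (y - p i)).
have -> : feedback f r0 p beta i = (fun z : R * R => f z.1 z.2) \o h by [].
apply: differentiable_comp; last exact: f_diff.
by apply: differentiable_pair.
Qed.

Lemma near_lt_pos_ereal {R : realType} (M : \bar R) : (0 < M)%E ->
  \forall e \near (0 : R)^'+, (e%:E < M)%E.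
Proof.
case: M => [M|_|//]; last by near=> e; exact: ltry.
by rewrite lte_fin => M_gt0; near=> e; rewrite lte_fin; near: e; exact: nbhs_right_lt.
Unshelve. all: by end_near. Qed.

Lemma half_min_gap_gt0 {R : realType} {m : nat} (p : 'I_m -> R) :
  injective p -> (0 < half_min_gap p)%E.
Proof.
move=> p_inj; apply: lt_bigmin => [|[i j] /= ij]; first exact: ltry.
by rewrite lte_fin divr_gt0// normr_gt0 subr_eq0 (inj_eq p_inj).
Qed.

Lemma max_gain_ge {R : realType} {m : nat} (beta : 'I_m -> R) j :
  `|beta j| <= max_gain beta.
Proof. exact: le_bigmax. Qed.

Lemma max_gain_ge0 {R : realType} {m : nat} (beta : 'I_m -> R) :
  0 <= max_gain beta.
Proof. exact: bigmax_ge_id. Qed.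

(** This includes [b = 0], where the quotient is [+oo]. *)
Lemma divided_by_gain_gt0 {R : realType} (d b : R) : 0 < d -> 0 <= b ->
  (0 < d%:E / b%:E)%E.
Proof.
move=> d_gt0; rewrite le0r => /orP[/eqP->|b_gt0].
  by rewrite inve0 gt0_muley ?lte_fin.
by rewrite mule_gt0 ?lte_fin// inve_gt0 ?lte_fin// eqe gt_eqF.
Qed.

(** If the control stayed off forever, the trajectory would be the
    uncontrolled one, which does come close to the orbit. *)
Lemma control_switches_on {R : realType} (f : R -> R -> R) (r0 : R) {m : nat}
    (p beta : 'I_m -> R) (eps : R) (x : nat -> R) :
  controlled_trajectory f r0 p beta eps x ->
  (exists k, near_orbit p eps (iter k (f^~ r0) (x 0%N))) ->
  exists k0 i, [/\ `|x k0 - p i| <= eps,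
    forall k, (k < k0)%N -> control p beta eps x k = 0 &
    forall n, control p beta eps x (n + k0) =
      beta (ord_shift i n) * (x (n + k0)%N - p (ord_shift i n))].
Proof.
move=> x_traj [k near_k].
have [near_x|never] := pselect (exists k, near_orbit p eps (x k)); last first.
  have control0 n : control p beta eps x n = 0.
    by rewrite /control /switch_time; case: pselect.
  case: never; exists k; suff -> : x k = iter k (f^~ r0) (x 0%N) by [].
  by elim: (k) => [//|n IH]; rewrite x_traj control0 addr0 IH.
have [k0 switch near_k0] : exists2 k0,
    switch_time p eps x = Some k0 & near_orbit p eps (x k0).
  rewrite /switch_time; case: pselect => // h.
  by exists (ex_minn h) => //; case: ex_minnP.
exists k0; rewrite /control switch.
case: pickP => [i start|none]; last by case/existsP: near_k0 => i; rewrite none.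
exists i; split=> // [j ->//|n].
by rewrite ltnNge leq_addl /= addnK.
Qed.

Theorem proposition2 (R : realType) (f : R -> R -> R) (r0 : R)
    (A B : set R) (m : nat) (p beta : 'I_m -> R) (delta : R)
    (f_C1 : continuously_differentiable f)
    (A_attractor : strange_attractor (f^~ r0) A)
    (B_basin : B = basin (f^~ r0) A)
    (m_gt0 : (0 < m)%N)
    (p_upo : unstable_periodic_orbit (f^~ r0) p)
    (p_in_A : forall i : 'I_m, A (p i))
    (p_visited : visits_orbit_ae (f^~ r0) B p)
    (beta_stab : `|\prod_(i < m) derive1 (feedback f r0 p beta i) (p i)| < 1)
    (delta_gt0 : 0 < delta) :
  exists eps0 : R,
    [/\ 0 < eps0,
        (eps0%:E < mine (half_min_gap p) (delta%:E / (max_gain beta)%:E))%E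
      & forall eps : R, 0 < eps < eps0 ->
        {ae @lebesgue_measure R, forall x0 : R, B x0 ->
          forall x : nat -> R, x 0%N = x0 ->
            controlled_trajectory f r0 p beta eps x ->
            (forall k, `|control p beta eps x k| < delta) /\
            converges_to_orbit p x}].
Proof.
have [[p_inj p_next] _] := p_upo.
pose g := feedback f r0 p beta; pose d i := `|derive1 (g i) (p i)|.
have g_orbit i : g i (p i) = p (ordS i).
  by rewrite /g /feedback subrr mulr0 addr0 -p_next.
have [e e_gt0 L_lt1] : exists2 e : R, 0 < e & \prod_(i < m) (d i + e) < 1.
  by apply: prod_slack; rewrite -normr_prod.
pose L i := d i + e.
have L_ge0 i : 0 <= L i by rewrite addr_ge0 ?normr_ge0 ?ltW.
have [rho [rho_gt0 g_gain]] : exists rho : R, 0 < rho /\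
    forall i y, `|y - p i| <= rho -> `|g i y - p (ordS i)| <= L i * `|y - p i|.
  apply: (@filter_ex _ (0^'+ : set_system R)).
  near=> rho; split; first by near: rho; exact: nbhs_right_gt.
  near: rho; apply: (@filter_forall _ _ (fun i rho => forall y, `|y - p i| <= rho ->
    `|g i y - p (ordS i)| <= L i * `|y - p i|)) => i; rewrite -g_orbit.
  by apply: derivable_local_gain => //; exact: feedback_derivable.
have [C C_gt0 gain_le] := path_gain_bounded L L_ge0 L_lt1.
have C_small (b : R) : 0 < b -> \forall eps0 \near 0^'+, C * eps0 < b.
  move=> b_gt0; near=> eps0; rewrite mulrC -ltr_pdivlMr//; near: eps0.
  by apply: nbhs_right_lt; rewrite divr_gt0.
have gain_ge0 := max_gain_ge0 beta.
(* [max_gain beta] may vanish; dividing by [max_gain beta + 1] avoids cases. *)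
have gain1_gt0 : 0 < max_gain beta + 1 by rewrite ltr_pwDr.
have [eps0 [eps0_gt0 [eps0_lt [C_rho C_delta]]]] : exists eps0 : R, 0 < eps0 /\
    (eps0%:E < mine (half_min_gap p) (delta%:E / (max_gain beta)%:E))%E /\
    C * eps0 < rho /\ C * eps0 < delta / (max_gain beta + 1).
  apply: (@filter_ex _ (0^'+ : set_system R)).
  near=> eps0; split; first by near: eps0; exact: nbhs_right_gt.
  split; last by split; near: eps0; apply: C_small; rewrite ?divr_gt0.
  near: eps0; apply: near_lt_pos_ereal.
  by rewrite lt_min half_min_gap_gt0// divided_by_gain_gt0.
exists eps0; split=> // eps /andP[eps_gt0 eps_lt].
apply: negligibleS p_visited; apply: subsetC => x0 visited Bx0 x x0E x_traj.
have [k0 [i [start off on]]] : exists k0 i, [/\ `|x k0 - p i| <= eps,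
    forall k, (k < k0)%N -> control p beta eps x k = 0 &
    forall n, control p beta eps x (n + k0) =
      beta (ord_shift i n) * (x (n + k0)%N - p (ord_shift i n))].
  apply: (control_switches_on _ _ _ _ _ _ x_traj).
  have [|k near_k] := visited Bx0 (Ordinal m_gt0) (ball (p (Ordinal m_gt0)) eps).
    exact: nbhsx_ballx.
  exists k; apply/existsP; exists (Ordinal m_gt0).
  by rewrite x0E distrC ltW.
have Cstart n : path_gain L i n * `|x k0 - p i| <= C * eps0.
  rewrite ler_pM ?path_gain_ge0//; exact: le_trans (ltW eps_lt).
have tracked n : `|x (n + k0)%N - p (ord_shift i n)| <=
    path_gain L i n * `|x k0 - p i|.
  have z_rec k : x (k.+1 + k0)%N = g (ord_shift i k) (x (k + k0)%N).
    by rewrite addSn x_traj on.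
  apply: (tracking_error g p L rho i (fun n => x (n + k0)%N)) => // k.
  exact: le_trans (Cstart k) (ltW C_rho).
split.
  move=> k; have [/off->|k0k] := ltnP k k0; first by rewrite normr0.
  rewrite -(subnK k0k) on normrM.
  have err := le_lt_trans (le_trans (tracked _) (Cstart (k - k0)%N)) C_delta.
  apply: (@le_lt_trans _ _ (max_gain beta * (delta / (max_gain beta + 1)))).
    by rewrite ler_pM// ?max_gain_ge// ltW.
  by rewrite mulrA ltr_pdivrMr// mulrC ltr_pM2l// ltrDl.
(* The index [i] is the phase at time [k0]; [s] is the phase at time 0. *)
have [s sE] := ord_shift_onto i k0.
exists s; rewrite -(cvg_shiftn k0).
apply: (@squeeze_cvgr _ _ _ _ (cst 0) (fun n => path_gain L i n * `|x k0 - p i|)).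
- by near=> n; rewrite normr_ge0 /= addnC ord_shiftD sE addnC tracked.
- exact: cvg_cst.
- by rewrite -[X in _ --> X](mul0r `|x k0 - p i|); apply: cvgMl; exact: path_gain_cvg0.
Unshelve. all: by end_near. Qed.
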